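(* Let $p,N,P\ge 1$ be integers, let $z_1,\dots,z_p\in\Omega\subset\mathbb{R}^2$ be the centers and $\phi_\epsilon:[0,\infty)\to\mathbb{R}$ the radial function (with width parameter $\epsilon>0$) of an RBF-DeepONet $$I_\theta[F](z)=\sum_{i=1}^p u_\theta^i(F)\,\phi_\epsilon(|z-z_i|),\qquad \theta\in\mathbb{R}^P,$$ with branch network $u_\theta=(u_\theta^1,\dots,u_\theta^p)^\top:\mathbb{C}^{m_0\times n_0}\to\mathbb{R}^p$ differentiable in $\theta$, and let $F_1,\dots,F_N\in\mathbb{C}^{m_0\times n_0}$ be training inputs. Let $K\in\mathbb{R}^{(Np)\times(Np)}$ be the neural tangent kernel matrix of the RBF-DeepONet, let $G\in\mathbb{R}^{(Np)\times(Np)}$ be the neural tangent kernel matrix of the branch network, and let $P_\epsilon\in\mathbb{R}^{p\times p}$ be the trunk matrix, $(P_\epsilon)_{ij}=\phi_\epsilon(|z_j-z_i|)$ (all at the same fixed parameter $\theta$, as defined in the context). Then $$\lambda_{\min}(G)\,\sigma_{\min}(P_\epsilon)^2\le\lambda_{\min}(K)\le\lambda_{\max}(K)\le\lambda_{\max}(G)\,\sigma_{\max}(P_\epsilon)^2,$$ where $\sigma_{\min}(P_\epsilon)$ and $\sigma_{\max}(P_\epsilon)$ denote the minimum and maximum singular values of $P_\epsilon$.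
   Context: The RBF-DeepONet has a trainable branch network $u_\theta$ (parameters $\theta\in\mathbb{R}^P$) and a fixed (parameter-free) trunk $$\Phi_\epsilon(z)=\bigl(\phi_\epsilon(|z-z_1|),\dots,\phi_\epsilon(|z-z_p|)\bigr)^\top\in\mathbb{R}^p,$$ so that $I_\theta[F](z)=u_\theta(F)^\top\Phi_\epsilon(z)$. The paper's choice of radial function is the Gaussian $\phi_\epsilon(r)=\exp(-\epsilon r^2)$. The network is evaluated at the pairs $(F_i,z_j)$, $1\le i\le N$, $1\le j\le p$, where the evaluation points $z_j$ are the centers themselves; the $Np$ pairs are ordered with $i$ as the outer (block) index and $j$ as the inner index. Let $\nabla_\theta u_\theta(F)\in\mathbb{R}^{p\times P}$ denote the Jacobian of $u_\theta(F)$ with respect to $\theta$, and $\nabla_\theta I_\theta[F](z)\in\mathbb{R}^{1\times P}$ the Jacobian (row vector) of $I_\theta[F](z)$ with respect to $\theta$. The neural tangent kernel matrix $K\in\mathbb{R}^{(Np)\times(Np)}$ of the RBF-DeepONet has entries $$K_{(i,j),(i',j')}=\nabla_\theta I_\theta[F_i](z_j)\,\nabla_\theta I_\theta[F_{i'}](z_{j'})^\top .$$ The neural tangent kernel matrix $G\in\mathbb{R}^{(Np)\times(Np)}$ of the branch network is the $N\times N$ block matrix with blocks $$G_{i,i'}=\nabla_\theta u_\theta(F_i)\,\nabla_\theta u_\theta(F_{i'})^\top\in\mathbb{R}^{p\times p}.$$ Equivalently, $K=(I_N\otimes P_\epsilon^\top)\,G\,(I_N\otimes P_\epsilon)$, where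 $I_N$ is the $N\times N$ identity and $\otimes$ is the Kronecker product. $\lambda_{\min},\lambda_{\max}$ denote the smallest and largest eigenvalues of a real symmetric matrix. *)

(* Defs.v *)
From mathcomp Require Import all_boot all_order all_algebra.
From mathcomp Require Import all_classical all_reals all_analysis.
From mathcomp Require Import complex mxtens.
Set Implicit Arguments.
Unset Strict Implicit.
Unset Printing Implicit Defensive.
Import Order.TTheory GRing.Theory Num.Theory.
Import numFieldNormedType.Exports.
Local Open Scope classical_set_scope.
Local Open Scope ring_scope.

(* The library norm on ['rV[R]_n] is the sup norm, whereas the radial function
   is applied to Euclidean distances. *)
Definition enorm (R : realType) (n : nat) (x : 'rV[R]_n) : R :=
  Num.sqrt (\sum_(i < n) x 0 i ^+ 2).

(* For a real symmetric matrix of positive size the set of eigenvalues is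
   finite and nonempty, so that the inf and the sup are attained. *)
Definition lambda_min (R : realType) (n : nat) (A : 'M[R]_n) : R :=
  inf [set a : R | eigenvalue A a].

Definition lambda_max (R : realType) (n : nat) (A : 'M[R]_n) : R :=
  sup [set a : R | eigenvalue A a].

(* Only used for square matrices: for a rectangular [A], the Gram matrix
   [A^T *m A] may have eigenvalues 0 that are not counted as singular
   values. *)
Definition singular_value (R : realType) (n : nat) (A : 'M[R]_n) (s : R) :
    Prop :=
  0 <= s /\ eigenvalue (A^T *m A) (s ^+ 2).

Definition sigma_min (R : realType) (n : nat) (A : 'M[R]_n) : R :=
  inf [set s : R | singular_value A s].

Definition sigma_max (R : realType) (n : nat) (A : 'M[R]_n) : R :=
  sup [set s : R | singular_value A s].

(* The library Jacobian ['J f x] acts on row vectors on the right, hence has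
   one row per variable; its transpose is the usual m x n Jacobian. *)
Definition grad (R : realType) (n m : nat) (f : 'rV[R]_n -> 'rV[R]_m)
    (x : 'rV[R]_n) : 'M[R]_(m, n) :=
  ('J f x)^T.

Definition rbf_deeponet (R : realType) (X : Type) (p P : nat)
    (phi : R -> R) (z : 'I_p -> 'rV[R]_2)
    (u : 'rV[R]_P -> X -> 'rV[R]_p) (theta : 'rV[R]_P) (F : X)
    (y : 'rV[R]_2) : R :=
  \sum_(i < p) u theta F 0 i * phi (enorm (y - z i)).

Definition trunk_matrix (R : realType) (p : nat) (phi : R -> R)
    (z : 'I_p -> 'rV[R]_2) : 'M[R]_p :=
  \matrix_(i, j) phi (enorm (z j - z i)).

(* [mxtens_unindex : 'I_(N * p) -> 'I_N * 'I_p] sends k to (k %/ p, k %% p),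
   so the first component is the outer (block) index. *)
Definition ntk_deeponet (R : realType) (X : Type) (p N P : nat)
    (phi : R -> R) (z : 'I_p -> 'rV[R]_2)
    (u : 'rV[R]_P -> X -> 'rV[R]_p) (F : 'I_N -> X)
    (theta : 'rV[R]_P) : 'M[R]_(N * p) :=
  \matrix_(a, b)
    let: (i, j) := mxtens_unindex a in
    let: (i', j') := mxtens_unindex b in
    let gradI (k : 'I_N) (l : 'I_p) : 'rV[R]_P :=
      grad (fun t => (rbf_deeponet phi z u t (F k) (z l))%:M : 'rV[R]_1)
           theta in
    (gradI i j *m (gradI i' j')^T) 0 0.

Definition ntk_branch (R : realType) (X : Type) (p N P : nat)
    (u : 'rV[R]_P -> X -> 'rV[R]_p) (F : 'I_N -> X)
    (theta : 'rV[R]_P) : 'M[R]_(N * p) :=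
  \matrix_(a, b)
    let: (i, j) := mxtens_unindex a in
    let: (i', j') := mxtens_unindex b in
    let gradu (k : 'I_N) : 'M[R]_(p, P) :=
      grad (fun t => u t (F k)) theta in
    (gradu i *m (gradu i')^T) j j'.

(* Main.v *)
Require Import Defs.
From mathcomp Require Import all_boot all_order all_algebra.
From mathcomp Require Import all_classical all_reals all_analysis.
From mathcomp Require Import complex mxtens ring.
Import Order.TTheory GRing.Theory Num.Theory.
Import numFieldNormedType.Exports.
Local Open Scope classical_set_scope.
Local Open Scope ring_scope.

(** Stack the Jacobians of the branch network at the N training inputs into one
    matrix J with N * p rows. Then G = J J^T, and because the trunk does not
    depend on the parameters, the Jacobian of the operator network at the pair
    (F_i, z_j) is the j-th row of P_eps^T times the Jacobian of the branch at
    F_i ([grad_rbf_deeponet]). Hence K = (T J) (T J)^T with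
    T = I_N (x) P_eps^T ([ntk_branch_gram], [ntk_deeponet_gram]), which in
    terms of quadratic forms of row vectors says that the form of K at v is the
    form of G at v T.

    The extreme eigenvalues of a symmetric matrix are the optimal constants in
    c |v|^2 <= v A v^T and v A v^T <= c |v|^2 ([lambda_min_le_quad_form],
    [le_lambda_min] and their counterparts for the maximum). So K is bounded by
    chaining two estimates: the form of G at v T lies between
    lambda_min(G) |v T|^2 and lambda_max(G) |v T|^2, and T acts on each of the
    N blocks of v as P_eps^T, so that |v T|^2 lies between
    sigma_min(P_eps)^2 |v|^2 and sigma_max(P_eps)^2 |v|^2
    ([sigma_min_sqr_le], [le_sigma_max_sqr]). The chaining uses that the
    eigenvalues of the Gram matrix G are nonnegative.

    The variational description of the eigenvalues comes from the spectral
    theorem for Hermitian matrices over the complex numbers, brought back to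
    the reals in [symmetric_diagonalization]. *)

(** * Quadratic forms of real symmetric matrices *)

Definition quad_form {R : realType} {n : nat} (A : 'M[R]_n)
    (v : 'rV[R]_n) : R :=
  (v *m A *m v^T) 0 0.

Definition sqnorm {R : realType} {n : nat} (v : 'rV[R]_n) : R :=
  (v *m v^T) 0 0.

Lemma sqnormE {R : realType} {n : nat} (v : 'rV[R]_n) :
  sqnorm v = \sum_i v 0 i ^+ 2.
Proof. by rewrite /sqnorm mxE; apply: eq_bigr => i _; rewrite mxE. Qed.

Lemma sqnorm_ge0 {R : realType} {n : nat} (v : 'rV[R]_n) : 0 <= sqnorm v.
Proof. by rewrite sqnormE sumr_ge0 // => i _; exact: sqr_ge0. Qed.

Lemma sqnorm_gt0 {R : realType} {n : nat} (v : 'rV[R]_n) :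
  v != 0 -> 0 < sqnorm v.
Proof.
move=> /eqP v0; rewrite lt0r sqnorm_ge0 andbT; apply/eqP => /eqP.
rewrite sqnormE psumr_eq0 => [/allP vi0|i _]; last exact: sqr_ge0.
apply: v0; apply/rowP => i; rewrite mxE; apply/eqP.
by rewrite -sqrf_eq0; exact: vi0 (mem_index_enum i).
Qed.

Lemma quad_form_gram {R : realType} {n m : nat} (B : 'M[R]_(n, m))
    (v : 'rV[R]_n) :
  quad_form (B *m B^T) v = sqnorm (v *m B).
Proof. by rewrite /quad_form /sqnorm trmx_mul !mulmxA. Qed.

Lemma eigenvalue_quad_form {R : realType} {n : nat} {A : 'M[R]_n} {a : R} :
  eigenvalue A a ->
  exists2 v : 'rV[R]_n, 0 < sqnorm v & quad_form A v = a * sqnorm v.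
Proof.
move=> /eigenvalueP[v vA v0]; exists v; first exact: sqnorm_gt0.
by rewrite /quad_form vA -scalemxAl mxE.
Qed.

(** Only the squared moduli w of the coordinates of v in an orthonormal
    eigenbasis enter the quadratic form. They are real even when the eigenbasis
    is complex, so that the unitary diagonalization over R[i] suffices and no
    real orthogonal eigenbasis has to be built. *)
Lemma symmetric_diagonalization {R : realType} {n : nat} {A : 'M[R]_n} :
  A^T = A ->
  exists2 d : 'I_n -> R, (forall i, eigenvalue A (d i)) &
    forall v : 'rV[R]_n, exists w : 'I_n -> R,
      [/\ forall i, 0 <= w i, sqnorm v = \sum_i w i
        & quad_form A v = \sum_i d i * w i].
Proof.
move=> Asym; set f := real_complex R : {rmorphism R -> complex R}.
have freal (x : R) : f x \is Num.real by rewrite /f /= complex_real.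
pose B := map_mx f A.
have Breal : B \is a mxOver Num.real.
  by apply/mxOverP => i j; rewrite mxE complex_real.
have Bherm : B \is hermsymmx.
  apply: realsym_hermsym => //; apply/is_hermitianmxP.
  by rewrite expr0 scale1r map_mx_id // /B map_trmx Asym.
have /orthomx_spectralP Beq := hermitian_normalmx Bherm.
have Dreal := hermitian_spectral_diag_real Bherm.
set U := spectralmx B in Beq; set D := spectral_diag B in Beq Dreal.
have Uunit : U \in unitmx := spectral_unit B.
have UU : invmx U = (U^T ^ Num.conj)%sesqui.
  exact: invmx_unitary (spectral_unitarymx B).
have fRe (x : complex R) : x \is Num.real -> f (complex.Re x) = x.
  exact: RRe_real.
exists (fun i => complex.Re (D 0 i)).
  (* A real root of the characteristic polynomial over R[i] is a root of the
     characteristic polynomial over R. *)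
  move=> i; rewrite eigenvalue_root_char -(fmorph_root f) map_char_poly.
  rewrite -/B -eigenvalue_root_char fRe; last exact: (mxOverP _ _).
  apply/eigenvalueP; exists (row i U).
    rewrite -row_mul Beq !mulmxA mulmxV // mul1mx; apply/rowP => j.
    by rewrite row_mul row_diag_mx -scalemxAl -rowE.
  by apply: contraTneq Uunit => Ui0; rewrite -row_free_unit; apply/row_freePn;
    exists i; rewrite Ui0 sub0mx.
move=> v; pose y := map_mx f v *m invmx U.
have yc : y *m U = map_mx f v by rewrite mulmxKV.
(* Since v is real, its transpose is also its adjoint. *)
have yconj : U *m (map_mx f v)^T = (y^T ^ Num.conj)%sesqui.
  rewrite /y UU trmx_mul map_mxM -[in RHS]map_trmx trmxK -map_mx_comp.
  rewrite (map_mx_id (@Num.Theory.conjCK _)); congr (_ *m _).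
  apply/matrixP => i j; rewrite !mxE; apply/esym/CrealP.
  exact: freal.
have wge i : 0 <= y 0 i * (y 0 i)^*%R by exact: mul_conjC_ge0.
have wR i : f (complex.Re (y 0 i * (y 0 i)^*%R)) = y 0 i * (y 0 i)^*%R.
  by apply: fRe; exact: ger0_real.
exists (fun i => complex.Re (y 0 i * (y 0 i)^*%R)); split.
- by move=> i; rewrite -ler0c; move: (wge i); rewrite -wR.
- apply: (fmorph_inj f); rewrite /sqnorm rmorph_sum /=.
  transitivity ((map_mx f v *m (map_mx f v)^T) 0 0).
    by rewrite map_trmx -map_mxM [RHS]mxE.
  rewrite -{1}yc -mulmxA yconj mxE.
  by apply: eq_bigr => i _; rewrite -/(f _) wR !mxE.
- apply: (fmorph_inj f); rewrite /quad_form rmorph_sum /=.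
  transitivity ((map_mx f v *m B *m (map_mx f v)^T) 0 0).
    by rewrite map_trmx -!map_mxM [RHS]mxE.
  rewrite Beq !mulmxA -/y -mulmxA yconj mxE.
  apply: eq_bigr => i _.
  rewrite -/(f _) rmorphM wR fRe ?(mxOverP _ _)//.
  by rewrite mul_mx_diag !mxE mulrAC mulrC.
Qed.

(** * Extreme eigenvalues as extrema of the Rayleigh quotient *)

Lemma rayleigh_ge {R : realType} {n : nat} {A : 'M[R]_n} (c : R)
    (v : 'rV[R]_n) :
  A^T = A -> (forall a, eigenvalue A a -> c <= a) ->
  c * sqnorm v <= quad_form A v.
Proof.
move=> /symmetric_diagonalization[d dA /(_ v)[w [w0 -> ->]]] cA.
by rewrite mulr_sumr ler_sum // => i _; rewrite ler_wpM2r // cA.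
Qed.

Lemma rayleigh_le {R : realType} {n : nat} {A : 'M[R]_n} (c : R)
    (v : 'rV[R]_n) :
  A^T = A -> (forall a, eigenvalue A a -> a <= c) ->
  quad_form A v <= c * sqnorm v.
Proof.
move=> /symmetric_diagonalization[d dA /(_ v)[w [w0 -> ->]]] cA.
by rewrite mulr_sumr ler_sum // => i _; rewrite ler_wpM2r // cA.
Qed.

Lemma symmetric_eigenvalue_exists {R : realType} {n : nat} {A : 'M[R]_n} :
  (0 < n)%N -> A^T = A -> exists a, eigenvalue A a.
Proof.
by move=> n0 /symmetric_diagonalization[d dA _]; exists (d (Ordinal n0)).
Qed.

(** At an eigenvector of a the quadratic form is a times the total weight, and
    also the sum of the d i weighted by w; the crude bound by the sum of the
    |d i| is enough to make the infimum and the supremum of the spectrum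
    meaningful. *)
Lemma symmetric_eigenvalue_bounded {R : realType} {n : nat} {A : 'M[R]_n} :
  A^T = A -> exists c, forall a, eigenvalue A a -> `|a| <= c.
Proof.
move=> /symmetric_diagonalization[d _ dV]; exists (\sum_i `|d i|) => a.
move=> /eigenvalue_quad_form[v v0 Av]; have [w [w0 vE AvE]] := dV v.
have dle i : `|d i| <= \sum_j `|d j|.
  by rewrite (bigD1 i) //= lerDl sumr_ge0.
rewrite -(ler_pM2r v0) -[X in _ * X <= _](gtr0_norm v0) -normrM -Av AvE vE.
apply: (le_trans (ler_norm_sum _ _ _)); rewrite mulr_sumr ler_sum // => i _.
by rewrite normrM (ger0_norm (w0 i)) ler_wpM2r.
Qed.

Lemma eigenvalues_has_lbound {R : realType} {n : nat} {A : 'M[R]_n} :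
  A^T = A -> has_lbound [set a : R | eigenvalue A a].
Proof.
move=> /symmetric_eigenvalue_bounded[c cA]; exists (- c) => a /cA.
by rewrite ler_norml => /andP[].
Qed.

Lemma eigenvalues_has_ubound {R : realType} {n : nat} {A : 'M[R]_n} :
  A^T = A -> has_ubound [set a : R | eigenvalue A a].
Proof.
move=> /symmetric_eigenvalue_bounded[c cA]; exists c => a /cA.
by rewrite ler_norml => /andP[].
Qed.

Lemma lambda_min_le_quad_form {R : realType} {n : nat} {A : 'M[R]_n}
    (v : 'rV[R]_n) :
  A^T = A -> lambda_min A * sqnorm v <= quad_form A v.
Proof.
by move=> As; apply: rayleigh_ge => // a Aa; apply: ge_inf => //;
  exact: eigenvalues_has_lbound.
Qed.

Lemma quad_form_le_lambda_max {R : realType} {n : nat} {A : 'M[R]_n}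
    (v : 'rV[R]_n) :
  A^T = A -> quad_form A v <= lambda_max A * sqnorm v.
Proof.
by move=> As; apply: rayleigh_le => // a Aa; apply: ub_le_sup => //;
  exact: eigenvalues_has_ubound.
Qed.

(** With [lambda_min_le_quad_form], this characterizes [lambda_min A] as the
    largest lower bound of the Rayleigh quotient. The positive size matters:
    the infimum of an empty spectrum is 0. *)
Lemma le_lambda_min {R : realType} {n : nat} {A : 'M[R]_n} (c : R) :
  (0 < n)%N -> A^T = A -> (forall v, c * sqnorm v <= quad_form A v) ->
  c <= lambda_min A.
Proof.
move=> n0 As cA; apply: lb_le_inf; first exact: symmetric_eigenvalue_exists.
move=> a /eigenvalue_quad_form[v v0 Av].
by rewrite -(ler_pM2r v0) -Av.
Qed.

Lemma lambda_max_le {R : realType} {n : nat} {A : 'M[R]_n} (c : R) :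
  (0 < n)%N -> A^T = A -> (forall v, quad_form A v <= c * sqnorm v) ->
  lambda_max A <= c.
Proof.
move=> n0 As cA; apply: ge_sup; first exact: symmetric_eigenvalue_exists.
move=> a /eigenvalue_quad_form[v v0 Av].
by rewrite -(ler_pM2r v0) -Av.
Qed.

Lemma lambda_min_le_max {R : realType} {n : nat} {A : 'M[R]_n} :
  (0 < n)%N -> A^T = A -> lambda_min A <= lambda_max A.
Proof.
move=> n0 As; have [a Aa] := symmetric_eigenvalue_exists n0 As.
apply: (@le_trans _ _ a).
  by apply: ge_inf => //; exact: eigenvalues_has_lbound.
by apply: ub_le_sup => //; exact: eigenvalues_has_ubound.
Qed.

(** * Singular values *)

Lemma gram_sym {R : realType} {n m : nat} (B : 'M[R]_(n, m)) :
  (B *m B^T)^T = B *m B^T.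
Proof. by rewrite trmx_mul trmxK. Qed.

Lemma lambda_min_gram_ge0 {R : realType} {n m : nat} (B : 'M[R]_(n, m)) :
  (0 < n)%N -> 0 <= lambda_min (B *m B^T).
Proof.
move=> n0; apply: le_lambda_min (gram_sym B) _ => // v.
by rewrite mul0r quad_form_gram sqnorm_ge0.
Qed.

Lemma gram_eigenvalue_ge0 {R : realType} {n m : nat} {B : 'M[R]_(n, m)}
    {a : R} :
  eigenvalue (B *m B^T) a -> 0 <= a.
Proof.
move=> /eigenvalue_quad_form[v v0]; rewrite quad_form_gram => va.
by rewrite -(pmulr_lge0 _ v0) -va sqnorm_ge0.
Qed.

(** Singular values are defined through their squares, so every eigenvalue of
    the Gram matrix has to be seen as a square in order to be compared with the
    infimum and the supremum of the singular values. *)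
Lemma singular_value_sqrt {R : realType} {n : nat} {A : 'M[R]_n} {a : R} :
  eigenvalue (A^T *m A) a ->
  0 <= a /\ singular_value A (Num.sqrt a).
Proof.
move=> Aa; have a0 : 0 <= a.
  by apply: (@gram_eigenvalue_ge0 _ _ _ A^T); rewrite trmxK.
by split=> //; split; rewrite ?sqrtr_ge0 ?sqr_sqrtr.
Qed.

Lemma gram_tr_sym {R : realType} {n m : nat} (B : 'M[R]_(n, m)) :
  (B^T *m B)^T = B^T *m B.
Proof. by rewrite trmx_mul trmxK. Qed.

Lemma singular_values_has_ubound {R : realType} {n : nat} (A : 'M[R]_n) :
  has_ubound [set s : R | singular_value A s].
Proof.
have [c cA] := eigenvalues_has_ubound (gram_tr_sym A).
exists (c + 1) => s [s0 /cA]; rewrite /= => sc.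
(* s <= s ^+ 2 + 1, whether s is below or above 1. *)
apply: le_trans (lerD sc (lexx 1)).
rewrite -subr_ge0 (_ : _ - s = (s - 1) ^+ 2 + s) ?addr_ge0 ?sqr_ge0 //.
ring.
Qed.

(** v A^T is the row form of A v^T, and its square norm is the quadratic form
    of A^T A, whose eigenvalues are the squares of the singular values. *)
Lemma sigma_min_sqr_le {R : realType} {n : nat} {A : 'M[R]_n} (v : 'rV[R]_n) :
  sigma_min A ^+ 2 * sqnorm v <= sqnorm (v *m A^T).
Proof.
rewrite -quad_form_gram trmxK; apply: rayleigh_ge; first exact: gram_tr_sym.
move=> a /singular_value_sqrt[a0 Aa].
rewrite -[leRHS](sqr_sqrtr a0) lerXn2r // ?nnegrE ?sqrtr_ge0 //.
- by apply: lb_le_inf; [exists (Num.sqrt a)|move=> s []].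
- by apply: ge_inf => //; exists 0 => s [].
Qed.

Lemma le_sigma_max_sqr {R : realType} {n : nat} {A : 'M[R]_n} (v : 'rV[R]_n) :
  sqnorm (v *m A^T) <= sigma_max A ^+ 2 * sqnorm v.
Proof.
rewrite -quad_form_gram trmxK; apply: rayleigh_le; first exact: gram_tr_sym.
move=> a /singular_value_sqrt[a0 Aa].
have sa : Num.sqrt a <= sigma_max A.
  by apply: ub_le_sup => //; exact: singular_values_has_ubound.
rewrite -[leLHS](sqr_sqrtr a0) lerXn2r // ?nnegrE ?sqrtr_ge0 //.
exact: le_trans (sqrtr_ge0 a) sa.
Qed.

(** * Block-diagonal action of the trunk *)

(** The i-th block of v, for the ordering of indices used by [tensmx]. *)
Definition row_block {R : realType} {N p : nat} (v : 'rV[R]_(N * p))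
    (i : 'I_N) : 'rV[R]_p :=
  \row_j v 0 (mxtens_index (i, j)).

Lemma sum_mxtens_index {R : realType} {N p : nat} (g : 'I_(N * p) -> R) :
  \sum_k g k = \sum_(i < N) \sum_(j < p) g (mxtens_index (i, j)).
Proof.
rewrite pair_bigA /=.
have mxtens_index_bij : {on predT, bijective (@mxtens_index N p)}.
  by exists (@mxtens_unindex N p) => k _;
    [exact: mxtens_indexK|exact: mxtens_unindexK].
by rewrite (reindex _ mxtens_index_bij) /=; apply: eq_bigr => -[].
Qed.

Lemma sqnorm_row_block {R : realType} {N p : nat} (v : 'rV[R]_(N * p)) :
  sqnorm v = \sum_i sqnorm (row_block v i).
Proof.
rewrite sqnormE sum_mxtens_index; apply: eq_bigr => i _.
by rewrite sqnormE; apply: eq_bigr => j _; rewrite mxE.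
Qed.

(** Right multiplication by I (x) B multiplies each block by B; this turns norm
    estimates for B into the same estimates for I (x) B. *)
Lemma row_block_tens1 {R : realType} {N p q : nat} (B : 'M[R]_(p, q))
    (v : 'rV[R]_(N * p)) (i : 'I_N) :
  row_block (v *m tensmx 1%:M B) i = row_block v i *m B.
Proof.
apply/rowP => j; rewrite 2![LHS]mxE [RHS]mxE sum_mxtens_index.
rewrite (bigD1 i) //= [X in _ + X]big1 ?addr0.
  by apply: eq_bigr => k _; rewrite tensmxE !mxE eqxx mul1r.
move=> i' ii'; apply: big1 => k _.
by rewrite tensmxE !mxE (negPf ii') mul0r mulr0.
Qed.

Definition block_col {R : realType} {N p q : nat} (M : 'I_N -> 'M[R]_(p, q)) :
    'M[R]_(N * p, q) :=
  \matrix_(a, k) M (mxtens_unindex a).1 (mxtens_unindex a).2 k.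

Lemma tens1_block_col {R : realType} {N p q r : nat} (B : 'M[R]_(r, p))
    (M : 'I_N -> 'M[R]_(p, q)) :
  tensmx 1%:M B *m block_col M = block_col (fun i => B *m M i).
Proof.
apply/matrixP => a k; case: (mxtens_indexP a) => i j.
rewrite [LHS]mxE [RHS]mxE mxtens_indexK [RHS]mxE sum_mxtens_index
  (bigD1 i) //= [X in _ + X]big1 ?addr0.
  by apply: eq_bigr => l _; rewrite tensmxE !mxE mxtens_indexK eqxx mul1r.
move=> i' ii'; apply: big1 => l _.
by rewrite tensmxE !mxE eq_sym (negPf ii') !mul0r.
Qed.

(** * The two kernels as Gram matrices *)

(** v B is a combination of the fixed rows of B whose coefficients are the
    entries of v. *)
Lemma mulmxr_continuous {R : realType} {m q : nat} (B : 'M[R]_(m, q)) :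
  continuous (fun v : 'rV[R]_m => v *m B).
Proof.
rewrite (_ : (fun _ => _) = fun w : 'rV[R]_m => \sum_k w 0 k *: row k B);
  last by apply/funext => w; rewrite mulmx_sum_row.
apply: continuous_big; first exact: add_continuous.
move=> i _ v.
by apply: (@continuous_comp _ _ _ (fun w : 'rV[R]_m => w 0 i)
    ( *:%R^~ (row i B)));
  [exact: coord_continuous|exact: scalel_continuous].
Qed.

(** Chain rule for a linear outer map; B appears transposed because [grad] has
    one row per component whereas vectors are rows. *)
Lemma grad_mulmxr {R : realType} {n m q : nat} (f : 'rV[R]_n -> 'rV[R]_m)
    (B : 'M[R]_(m, q)) (x : 'rV[R]_n) :
  differentiable f x -> grad (fun t => f t *m B) x = B^T *m grad f x.
Proof.
move=> df; rewrite /grad -trmx_mul; congr (_^T).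
have cB : continuous (mulmxr B : 'rV[R]_m -> 'rV[R]_q) := mulmxr_continuous B.
apply/row_matrixP => i; rewrite !rowE mulmxA /jacobian !mul_rV_lin1.
rewrite (_ : (fun t => _) = (mulmxr B \o f)) // diff_comp //=.
  by rewrite diff_lin.
exact: linear_differentiable.
Qed.

(** Evaluated at a center, the network is a fixed linear map, independent of
    the parameters, applied to the branch. *)
Lemma rbf_deeponet_mulmx {R : realType} {X : Type} {p P : nat} (phi : R -> R)
    (z : 'I_p -> 'rV[R]_2) (u : 'rV[R]_P -> X -> 'rV[R]_p)
    (t : 'rV[R]_P) (F : X) (l : 'I_p) :
  (rbf_deeponet phi z u t F (z l))%:M = u t F *m col l (trunk_matrix phi z)
    :> 'rV[R]_1.
Proof.
apply/rowP => i; rewrite ord1 !mxE eqxx mulr1n.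
by apply: eq_bigr => k _; rewrite !mxE.
Qed.

Lemma grad_rbf_deeponet {R : realType} {X : Type} {p P : nat} (phi : R -> R)
    (z : 'I_p -> 'rV[R]_2) (u : 'rV[R]_P -> X -> 'rV[R]_p)
    (theta : 'rV[R]_P) (F : X) (l : 'I_p) :
  differentiable (fun t => u t F) theta ->
  grad (fun t => (rbf_deeponet phi z u t F (z l))%:M : 'rV[R]_1) theta =
  row l ((trunk_matrix phi z)^T *m grad (fun t => u t F) theta).
Proof.
move=> du; under [X in grad X]eq_fun do rewrite rbf_deeponet_mulmx.
by rewrite grad_mulmxr // tr_col row_mul.
Qed.

Lemma ntk_branch_gram {R : realType} {X : Type} {p N P : nat}
    (u : 'rV[R]_P -> X -> 'rV[R]_p) (F : 'I_N -> X) (theta : 'rV[R]_P) :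
  let J := block_col (fun i => grad (fun t => u t (F i)) theta) in
  ntk_branch u F theta = J *m J^T.
Proof.
move=> J; apply/matrixP => a b; rewrite [LHS]mxE [RHS]mxE /= mxE.
by apply: eq_bigr => k _; rewrite !mxE.
Qed.

(** The factorization K = T G T^T, kept in the Gram form that shows at once
    that K is symmetric. *)
Lemma ntk_deeponet_gram {R : realType} {X : Type} {p N P : nat}
    (phi : R -> R) (z : 'I_p -> 'rV[R]_2) (u : 'rV[R]_P -> X -> 'rV[R]_p)
    (F : 'I_N -> X) (theta : 'rV[R]_P) :
  (forall i, differentiable (fun t => u t (F i)) theta) ->
  let J := block_col (fun i => grad (fun t => u t (F i)) theta) in
  let T := tensmx 1%:M (trunk_matrix phi z)^T in
  ntk_deeponet phi z u F theta = (T *m J) *m (T *m J)^T.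
Proof.
move=> du J T; rewrite tens1_block_col; apply/matrixP => a b.
rewrite [LHS]mxE [RHS]mxE /= !grad_rbf_deeponet // mxE.
by apply: eq_bigr => k _; rewrite !mxE.
Qed.

Theorem theorem3p1 (R : realType) (p N P m0 n0 : nat)
    (hp : (0 < p)%N) (hN : (0 < N)%N) (hP : (0 < P)%N)
    (Omega : set 'rV[R]_2) (z : 'I_p -> 'rV[R]_2)
    (hz : forall i : 'I_p, Omega (z i))
    (phi : R -> R -> R) (eps : R) (heps : 0 < eps)
    (u : 'rV[R]_P -> 'M[complex R]_(m0, n0) -> 'rV[R]_p)
    (hu : forall (F : 'M[complex R]_(m0, n0)) (theta : 'rV[R]_P),
        differentiable (fun t : 'rV[R]_P => u t F) theta)
    (F : 'I_N -> 'M[complex R]_(m0, n0)) (theta : 'rV[R]_P) :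
  let K := ntk_deeponet (phi eps) z u F theta in
  let G := ntk_branch u F theta in
  let Peps := trunk_matrix (phi eps) z in
  [/\ lambda_min G * sigma_min Peps ^+ 2 <= lambda_min K,
      lambda_min K <= lambda_max K
    & lambda_max K <= lambda_max G * sigma_max Peps ^+ 2].
Proof.
move=> K G Q.
pose J := block_col (fun i => grad (fun t => u t (F i)) theta).
pose T : 'M[R]_(N * p) := tensmx 1%:M Q^T.
have GE : G = J *m J^T by exact: ntk_branch_gram.
have KE : K = (T *m J) *m (T *m J)^T by exact: ntk_deeponet_gram.
have Gs : G^T = G by rewrite GE gram_sym.
have Ks : K^T = K by rewrite KE gram_sym.
have Np_gt0 : (0 < N * p)%N by rewrite muln_gt0 hN.
have G0 : 0 <= lambda_min G by rewrite GE; exact: lambda_min_gram_ge0.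
have KG v : quad_form K v = quad_form G (v *m T).
  by rewrite KE GE !quad_form_gram mulmxA.
have Tmin v : sigma_min Q ^+ 2 * sqnorm v <= sqnorm (v *m T).
  rewrite !sqnorm_row_block mulr_sumr ler_sum // => i _.
  by rewrite row_block_tens1 sigma_min_sqr_le.
have Tmax v : sqnorm (v *m T) <= sigma_max Q ^+ 2 * sqnorm v.
  rewrite !sqnorm_row_block mulr_sumr ler_sum // => i _.
  by rewrite row_block_tens1 le_sigma_max_sqr.
split.
- apply: le_lambda_min => // v; rewrite KG -mulrA.
  apply: le_trans (lambda_min_le_quad_form _ Gs).
  (* The lower bound on |v T|^2 is multiplied by lambda_min G, hence the need
     for G to be positive semidefinite. *)
  by rewrite ler_wpM2l.
- exact: lambda_min_le_max.
- apply: lambda_max_le => // v; rewrite KG -mulrA.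
  apply: le_trans (quad_form_le_lambda_max _ Gs) _.
  by rewrite ler_wpM2l // (le_trans G0) // lambda_min_le_max.
Qed.
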